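(* Assume conditions (A0), (A1) and (A2) (stated in the context) and let $\mathrm{A}$ be any matrix with column span $\mathcal{M}$. Let $\mathbf{n}\in S(\mathrm{V})$ be the observed table and $\mathbf{t}=\mathrm{A}^\top\mathbf{n}$. Then the maximum likelihood estimator (MLE) of $\theta_{\mathcal{N}}$ (or, equivalently, of $\Pi_{\mathcal{M}\ominus\mathcal{N}}\mu$) exists and is unique if and only if $\mathbf{t}\in\mathrm{ri}(C_{\mathrm{A}})$, the relative interior of the marginal cone $C_{\mathrm A}$.
   Context: Setting. $\mathcal{I}$ is a finite set; $\mathbb{R}^{\mathcal{I}}$ carries the standard inner product $(\cdot,\cdot)$. $\mathcal{M}\subset\mathbb{R}^{\mathcal{I}}$ is a linear subspace (the log-linear subspace), and $\mathrm{A}$ is a real $|\mathcal{I}|\times d$ matrix, with nonzero rows $\mathbf{a}_i^\top$, whose column span is $\mathcal{M}$ ($\mathrm A$ need not have full column rank). $\mathcal{N}\subsetneq\mathcal{M}$ is a linear subspace of dimension $m$ (the sampling subspace), and $\mathrm{V}$ is an $|\mathcal{I}|\times m$ matrix whose columns form a basis of $\mathcal{N}$. $\mathcal{M}\ominus\mathcal{N}=\mathcal{M}\cap\mathcal{N}^\perp$ and $\Pi_{\mathcal{M}\ominus\mathcal{N}}$ is the orthogonal projector onto it. $S(\mathrm{V})=\{\mathbf{x}\in\mathbb{N}^{\mathcal{I}}: \mathrm{V}^\top\mathbf{x}=\mathbf{1}\}$ ($\mathbb{N}$ includes $0$; $\mathbf 1$ is the all-ones vector; if $m=0$ there is no constraint).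 $\nu_{\mathrm V}$ is the measure on $\mathbb{N}^{\mathcal{I}}$ giving mass $\prod_i 1/\mathbf{x}(i)!$ to each $\mathbf{x}\in S(\mathrm{V})$ and $0$ elsewhere. The exponential family has densities with respect to $\nu_{\mathrm V}$ $$p_\theta(\mathbf{x})=\exp\{(\mathrm{A}^\top\mathbf{x},\theta)-\psi(\theta)\},\quad \mathbf{x}\in S(\mathrm{V}),\ \theta\in\mathbb{R}^d,\qquad \psi(\theta)=\log\int_{S(\mathrm V)}\exp\{(\mathrm{A}^\top\mathbf{x},\theta)\}\,d\nu_{\mathrm V}(\mathbf{x}).$$ The log-linear parameter is $\mu=\mathrm{A}\theta\in\mathcal{M}$. (A0) $S(\mathrm{V})\neq\varnothing$. (A1) There is no $\gamma\in\mathcal{N}^\perp\setminus\{0\}$ such that $(\gamma,\mathbf{n})$ is constant almost everywhere with respect to $\nu_{\mathrm V}$; in particular, for no cell $i$ is $\mathbf{n}(i)=0$ almost everywhere $\nu_{\mathrm V}$. (A2) $\{\mathbf{x}\in\mathbb{R}^{\mathcal{I}}_{\ge0}:\mathrm{V}^\top\mathbf{x}=\mathbf{1}\}=\mathrm{conv}(S(\mathrm{V}))$. Let $\mathcal{Z}=\{\zeta\in\mathbb{R}^d:\mathrm{A}\zeta\in\mathcal{N}\}$; $\theta_{\mathcal{N}}=\theta+\mathcal{Z}$ is the equivalence class of $\theta$ (all parameters in a class specify the same distribution), and $\Theta_{\mathcal{N}}=\{\theta_{\mathcal{N}}:\theta\in\mathbb{R}^d\}$. The MLE of $\theta_{\mathcal{N}}$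 exists and is unique when $\sup_{\theta\in\mathbb{R}^d}p_\theta(\mathbf{n})$ is attained and the set of maximizers is exactly one class in $\Theta_{\mathcal{N}}$. The marginal cone is $C_{\mathrm{A}}=\mathrm{cone}(\mathrm{A}^\top)\subset\mathbb{R}^d$, the polyhedral cone spanned by the rows $\mathbf{a}_i$, $i\in\mathcal{I}$, of $\mathrm{A}$. *)

(* Defs.v *)
From HB Require Import structures.
From mathcomp Require Import all_boot all_order all_algebra.
From mathcomp Require Import all_classical all_reals all_analysis.

Set Implicit Arguments.
Unset Strict Implicit.
Unset Printing Implicit Defensive.

Import Order.TTheory GRing.Theory Num.Theory.
Import numFieldNormedType.Exports.

Local Open Scope classical_set_scope.
Local Open Scope ring_scope.

(* The cells of a finite index set I are numbered 0, ..., k - 1 with k = #|I|,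
   by [enum_rank]; R^I is 'cV[R]_k, N^I is [table k], and a matrix with rows
   indexed by I has k rows. *)

Section Euclidean.
Variables (R : realType) (k : nat).
Implicit Types (u v : 'cV[R]_k) (U W : {vspace 'cV[R]_k}).

Definition dot u v : R := \sum_(i < k) u i 0 * v i 0.

Definition colspan d (A : 'M[R]_(k, d)) : {vspace 'cV[R]_k} :=
  <<[seq col j A | j <- enum 'I_d]>>%VS.

Definition vbasis_mx U : 'M[R]_(k, \dim U) :=
  \matrix_(i < k, j < \dim U) (vbasis U)`_j i 0.

Definition orthv U : {vspace 'cV[R]_k} := lker (linfun (mulmx (vbasis_mx U)^T)).

Lemma orthvP U v : v \in orthv U <-> (forall u, u \in U -> dot u v = 0).
Proof.
have E j : (mulmx (vbasis_mx U)^T v) j 0 = dot (vbasis U)`_j v.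
  by rewrite mxE; apply: eq_bigr => i _; rewrite !mxE.
rewrite /orthv memv_ker lfunE /=; split.
  move=> /eqP Uv u /coord_vbasis ->.
  rewrite /dot; under eq_bigr do rewrite summxE mulr_suml.
  rewrite exchange_big big1 //= => j _.
  under eq_bigr do rewrite mxE -mulrA.
  by rewrite -mulr_sumr -/(dot _ _) -E Uv mxE mulr0.
move=> Uv; apply/eqP/matrixP => j i; rewrite ord1 E mxE.
by apply: Uv; apply: vbasis_mem; apply: mem_nth; rewrite size_tuple.
Qed.

(* M (-) N, the orthogonal complement of N within M *)
Definition ominus U W : {vspace 'cV[R]_k} := (U :&: orthv W)%VS.

(* [daddv_pi U W] projects onto U along W. *)
Definition orth_proj U : 'End('cV[R]_k) := daddv_pi U (orthv U).

Lemma capv_orthv U : (U :&: orthv U = 0)%VS.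
Proof.
apply/eqP; rewrite -subv0; apply/subvP => v; rewrite memv_cap => /andP[Uv].
move=> /orthvP /(_ _ Uv) /eqP; rewrite /dot.
rewrite psumr_eq0; last by move=> i _; rewrite -expr2 sqr_ge0.
move=> /allP v0; rewrite memv0; apply/eqP/matrixP => i j; rewrite ord1 mxE.
have := v0 i; rewrite mem_index_enum => /(_ isT).
by rewrite mulf_eq0 orbb => /eqP.
Qed.

Lemma addv_orthv U : (U + orthv U = fullv)%VS.
Proof.
apply/eqP; rewrite eqEdim subvf /= dimv_disjoint_sum ?capv_orthv //.
rewrite -(limg_ker_dim (linfun (mulmx (vbasis_mx U)^T)) fullv) capfv addnC.
rewrite leq_add2r (leq_trans (dimvS (subvf _))) // dimvf /dim /=.
by rewrite muln1.
Qed.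

Lemma orth_projP U v :
  orth_proj U v \in U /\ (forall u, u \in U -> dot u (v - orth_proj U v) = 0).
Proof.
split; first exact: memv_pi.
apply/orthvP; have vU : v \in (U + orthv U)%VS by rewrite addv_orthv memvf.
have {1}-> := esym (daddv_pi_add (capv_orthv U) vU).
by rewrite addrAC subrr add0r; exact: memv_pi.
Qed.

End Euclidean.

Section Convex.
Variables (R : realType) (E : lmodType R).
Implicit Type S : set E.

Definition conv S : set E :=
  [set y | exists (r : nat) (l : 'I_r -> R) (x : 'I_r -> E),
    [/\ forall i, S (x i), forall i, 0 <= l i, \sum_i l i = 1
      & y = \sum_i l i *: x i]].

Definition cone S : set E :=
  [set y | exists (r : nat) (l : 'I_r -> R) (x : 'I_r -> E),
    [/\ forall i, S (x i), forall i, 0 <= l i & y = \sum_i l i *: x i]].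

Definition affine_hull S : set E :=
  [set y | exists (r : nat) (l : 'I_r -> R) (x : 'I_r -> E),
    [/\ forall i, S (x i), \sum_i l i = 1 & y = \sum_i l i *: x i]].

End Convex.

Definition relint (R : realType) (d : nat) (C : set 'cV[R]_d) : set 'cV[R]_d :=
  [set x | C x /\ \forall y \near within (affine_hull C) (nbhs x), C y].

Definition marginal_cone (R : realType) (k d : nat) (A : 'M[R]_(k, d)) :
    set 'cV[R]_d :=
  cone [set (row i A)^T | i in [set: 'I_k]].

(* N^I with the discrete sigma-algebra *)
Definition table (k : nat) : Type := 'cV[nat]_k.
HB.instance Definition _ k := Countable.on (table k).
HB.instance Definition _ k := isPointed.Build (table k) (const_mx 0%N).
HB.instance Definition _ k := @isMeasurable.Build default_measure_display
  (table k) (@discrete_measurable (table k)) (@discrete_measurable0 _)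
  (@discrete_measurableC _) (@discrete_measurableU _).

Definition realv (R : realType) (k : nat) (x : table k) : 'cV[R]_k :=
  \col_i (x i 0)%:R.

Definition sampling_set (R : realType) (k m : nat) (V : 'M[R]_(k, m)) :
    set (table k) :=
  [set x | V^T *m realv R x = const_mx 1].

Section BaseMeasure.
Local Open Scope ereal_scope.
Variables (R : realType) (k m : nat) (V : 'M[R]_(k, m)).

Definition base_mass (x : table k) : \bar R :=
  (\prod_(i < k) ((x i 0%R)`!%:R)^-1)%:E.

Definition nu (B : set (table k)) : \bar R :=
  \esum_(x in B `&` sampling_set V) base_mass x.

Let mass_ge0 x : 0 <= base_mass x.
Proof.
by rewrite lee_fin; apply: prodr_ge0 => i _; rewrite invr_ge0 ler0n.
Qed.

Let nu0 : nu set0 = 0.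
Proof. by rewrite /nu set0I esum_set0. Qed.

Let nu_ge0 B : 0 <= nu B.
Proof. by apply: esum_ge0 => x _; exact: mass_ge0. Qed.

Let nu_sigma_additive : semi_sigma_additive nu.
Proof.
move=> F mF tF mU.
have -> : nu (\bigcup_n F n) = \sum_(n <oo) nu (F n).
  rewrite /nu setI_bigcupl esum_bigcupT //; last first.
    exact: trivIset_setIr.
  by rewrite nneseries_esumT // => n; exact: nu_ge0.
by apply: is_cvg_nneseries => n _ _; exact: nu_ge0.
Qed.

HB.instance Definition _ := isMeasure.Build _ (table k) R nu
  nu0 nu_ge0 nu_sigma_additive.

End BaseMeasure.

Section Model.
Variables (R : realType) (k d m : nat).
Variables (M N : {vspace 'cV[R]_k}) (A : 'M[R]_(k, d)) (V : 'M[R]_(k, m)).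
Implicit Types (x n : table k) (theta : 'cV[R]_d).

Definition condA0 : Prop := sampling_set V !=set0.

(* The second clause has to be required separately: it follows from the first
   one only for the cells i whose indicator vector is not in N. *)
Definition condA1 : Prop :=
  ~ (exists gamma : 'cV[R]_k, [/\ gamma \in orthv N, gamma != 0 &
      exists c : R, {ae nu V, forall x, dot gamma (realv R x) = c}]) /\
  (forall i : 'I_k, ~ {ae nu V, forall x, x i 0 = 0%N}).

Definition condA2 : Prop :=
  [set x : 'cV[R]_k | (forall i, 0 <= x i 0) /\ V^T *m x = const_mx 1] =
  conv [set realv R x | x in sampling_set V].

Definition suffstat x : 'cV[R]_d := A^T *m realv R x.

(* The integral is finite for every theta: it is at most
   \prod_i expR (expR ((A *m theta) i 0)). *)
Definition psi theta : R :=
  ln (fine (\int[nu V]_(x in sampling_set V)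
    (expR (dot (suffstat x) theta))%:E)%E).

(* density with respect to [nu V] *)
Definition density theta x : R := expR (dot (suffstat x) theta - psi theta).

Definition maximizers n : set 'cV[R]_d :=
  [set theta | forall theta', density theta' n <= density theta n].

Definition null_params : set 'cV[R]_d := [set zeta | A *m zeta \in N].

Definition param_class theta : set 'cV[R]_d :=
  [set theta + zeta | zeta in null_params].

Definition param_classes : set (set 'cV[R]_d) :=
  [set param_class theta | theta in [set: 'cV[R]_d]].

(* A class is nonempty, so this includes that the supremum is attained. *)
Definition class_mle_exists_unique n : Prop := param_classes (maximizers n).

(* the same for the parameter Pi_{M (-) N} mu, where mu = A theta *)
Definition proj_loglin_param theta : 'cV[R]_k :=
  orth_proj (ominus M N) (A *m theta).

Definition proj_mle_exists_unique n : Prop :=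
  exists omega : 'cV[R]_k,
    [set proj_loglin_param theta | theta in maximizers n] = [set omega].

End Model.

(* Main.v *)
Require Import Defs.
From mathcomp Require Import all_boot all_order all_algebra.
From mathcomp Require Import all_classical all_reals all_analysis.
From mathcomp Require Import ring lra.
Import Order.TTheory GRing.Theory Num.Theory.
Import numFieldNormedType.Exports.
Local Open Scope classical_set_scope.
Local Open Scope ring_scope.
Set Implicit Arguments.
Unset Strict Implicit.
Unset Printing Implicit Defensive.

(** Write t x = A^T x, t = t n, and let w x be the product of the 1 / x(i)!.
    The density at the observed table n is the inverse of

      F theta = \sum_(x in S(V)) w x * exp (t x - t, theta),

    so maximizing the likelihood means minimizing F, a convex sum of
    exponentials ([densityE], [maximizersP]).

    The set of minimizers is either empty or a single class.  F does not change
    along [null_params], because x - n is orthogonal to N for every x in S(V).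
    Conversely F is strictly convex along every direction zeta on which some
    (t x - t, zeta) is nonzero; if all of them vanish, then the component of
    A zeta orthogonal to N is constant on S(V), hence zero by [condA1], and
    zeta is in [null_params] ([maximizers_class]).  The projection onto M (-) N
    kills N, so it maps a class to one point, and both forms of existence and
    uniqueness reduce to the existence of a maximizer.

    The vector t lies in the relative interior of the marginal cone iff
    t = A^T y for some y with all entries positive ([relint_marginal_coneP]).

    If there is no such y, Stiemke's alternative ([stiemke]) provides zeta such
    that A zeta is nonnegative and nonzero and vanishes on the support of n.
    Replacing theta by theta - zeta lowers each (t x - t, theta) by
    (x, A zeta) >= 0, and strictly for a table x that charges a cell where
    A zeta is positive; such a table exists by the second part of [condA1].
    So F has no minimizer ([positive_of_maximizer]).

    If there is such a y, then y satisfies the sampling constraint, as N is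
    contained in the column span of A.  On the sublevel set {F <= F 0} every
    (t x - t, theta) is bounded above, since each summand is at most F 0.  For
    small e > 0 the point z = y + e (y - x) is nonnegative, so by [condA2] it is
    a convex combination of points of S(V), and A^T z - t = - e (t x - t).  This
    turns the upper bounds into a lower bound for (t x - t, theta).  As F
    depends on theta only through finitely many of these products, it attains
    its minimum by compactness ([expsum_attains_min],
    [exists_maximizer_of_positive]). *)

(** * The inner product *)

Section Dot.
Variables (R : realType) (k : nat).
Implicit Types (u v w : 'cV[R]_k) (a : R).

Lemma dotE u v : dot u v = (u^T *m v) 0 0.
Proof. by rewrite mxE; apply: eq_bigr => i _; rewrite mxE. Qed.

Lemma dotC u v : dot u v = dot v u.
Proof. by apply: eq_bigr => i _; rewrite mulrC. Qed.

Lemma dotDr u v w : dot u (v + w) = dot u v + dot u w.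
Proof. by rewrite !dotE mulmxDr mxE. Qed.

Lemma dotBr u v w : dot u (v - w) = dot u v - dot u w.
Proof. by rewrite !dotE mulmxBr !mxE. Qed.

Lemma dotZr a u v : dot u (a *: v) = a * dot u v.
Proof. by rewrite !dotE -scalemxAr mxE. Qed.

Lemma dotDl u v w : dot (u + v) w = dot u w + dot v w.
Proof. by rewrite dotC dotDr !(dotC w). Qed.

Lemma dotBl u v w : dot (u - v) w = dot u w - dot v w.
Proof. by rewrite dotC dotBr !(dotC w). Qed.

Lemma dotZl a u v : dot (a *: u) v = a * dot u v.
Proof. by rewrite dotC dotZr dotC. Qed.

Lemma dot0l v : dot 0 v = 0.
Proof. by rewrite -(scale0r 0) dotZl mul0r. Qed.

Lemma dot_suml J (r : seq J) (F : J -> 'cV[R]_k) v :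
  dot (\sum_(j <- r) F j) v = \sum_(j <- r) dot (F j) v.
Proof.
by apply: (big_morph (fun u => dot u v)) => [u w|]; rewrite ?dotDl ?dot0l.
Qed.

Lemma dotvv_ge0 v : 0 <= dot v v.
Proof. by apply: sumr_ge0 => i _; rewrite -expr2 sqr_ge0. Qed.

Lemma dotvv_eq0 v : (dot v v == 0) = (v == 0).
Proof.
apply/idP/eqP => [|->]; last by rewrite dot0l.
rewrite psumr_eq0; last by move=> i _; rewrite -expr2 sqr_ge0.
move=> /allP v0; apply/matrixP => i j; rewrite ord1 mxE.
by have := v0 i; rewrite mem_index_enum mulf_eq0 orbb => /(_ isT) /eqP.
Qed.

End Dot.

Lemma dot_trmx (R : realType) (k d : nat) (A : 'M[R]_(k, d)) (u : 'cV[R]_k)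
    (t : 'cV[R]_d) :
  dot (A^T *m u) t = dot u (A *m t).
Proof. by rewrite !dotE trmx_mul trmxK mulmxA. Qed.

(** * Theorems of the alternative *)

Lemma small_perturbation (R : realFieldType) (J : eqType) (s : seq J)
    (P Q : J -> R) : (forall i, i \in s -> 0 < P i) ->
  exists2 e, 0 < e & forall i, i \in s -> 0 < P i + e * Q i.
Proof.
move=> P0.
(* Every smaller step must work too, so that the minimum of two steps does. *)
suff [e e0 H] : exists2 e, 0 < e & forall e', 0 < e' <= e ->
    forall i, i \in s -> 0 < P i + e' * Q i.
  by exists e => // i; apply: H; rewrite e0 lexx.
elim: s P0 => [|a s IH] P0; first by exists 1.
have [i si|e e0 H] := IH; first by apply: P0; rewrite inE si orbT.
have Pa : 0 < P a by apply: P0; rewrite mem_head.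
have q0 : 0 < 1 + `|Q a| by rewrite ltr_pwDl.
exists (Num.min e (P a / (1 + `|Q a|))).
  by rewrite lt_min e0 divr_gt0.
move=> e' /andP[e'0]; rewrite le_min => /andP[e'e e'P] i.
rewrite inE => /predU1P[->|]; last by apply: H; rewrite e'0.
rewrite ler_pdivlMr // in e'P.
have : e' * - Q a <= e' * `|Q a| by rewrite ler_pM2l // -normrN ler_norm.
by nra.
Qed.

(** Gordan's alternative, by induction on the family.  If x is positive on all
    vectors but b a, replace every other b i by the nonnegative combination of
    b i and b a that is orthogonal to x.  A nonnegative relation among the new
    vectors is one among the old, and a y positive on the new vectors,
    corrected by multiples of x and b a, is positive on the old ones. *)
Lemma gordan (R : realType) (q : nat) (J : eqType) (s : seq J)
    (b : J -> 'cV[R]_q) : uniq s ->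
  (exists x, forall i, i \in s -> 0 < dot (b i) x) \/
  (exists l : J -> R, [/\ forall i, 0 <= l i, exists2 i, i \in s & 0 < l i
     & \sum_(i <- s) l i *: b i = 0]).
Proof.
elim: s b => [|a s IH] b /=; first by left; exists 0.
move=> /andP[as_ us].
have not_a i : i \in s -> (i == a) = false.
  by move=> si; apply: contraNF as_ => /eqP <-.
have [[x xP]|[l [l0 [i si li] lE]]] := IH b us; last first.
  right; exists (fun i => if i == a then 0 else l i); split.
  - by move=> j; case: eqP.
  - by exists i; rewrite ?not_a // inE si orbT.
  - rewrite big_cons eqxx scale0r add0r -[RHS]lE; apply: eq_big_seq => j sj.
    by rewrite not_a.
have [ax|ax] := ltP 0 (dot (b a) x).
  by left; exists x => i; rewrite inE => /predU1P[->//|]; exact: xP.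
set p := - dot (b a) x; have p0 : 0 <= p by rewrite oppr_ge0.
have [ba0|ba0] := eqVneq (b a) 0.
  right; exists (fun i => if i == a then 1 else 0); split.
  - by move=> j; case: eqP.
  - by exists a; rewrite ?mem_head ?eqxx.
  - rewrite big_cons eqxx ba0 scaler0 add0r big_seq big1 // => j sj.
    by rewrite not_a // scale0r.
have [[y yP]|[l [l0 [i si li] lE]]] :=
    IH (fun i => p *: b i + dot (b i) x *: b a) us.
  have [e e0 eP] := small_perturbation (fun i => dot (b i) (b a)) yP.
  (* The part without e is 0 on b a and positive on each other b i; the term
     e *: b a makes the value on b a positive. *)
  left; exists (p *: y + dot (b a) y *: x + e *: b a) => i.
  rewrite inE => /predU1P[->|si]; rewrite !dotDr !dotZr.
    have : 0 < dot (b a) (b a) by rewrite lt_def dotvv_eq0 ba0 dotvv_ge0.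
    by rewrite /p; nra.
  by have := eP i si; rewrite dotDl !dotZl; lra.
right; exists (fun i => if i == a then \sum_(j <- s) l j * dot (b j) x
                        else p * l i).
have s0 : 0 < \sum_(j <- s) l j * dot (b j) x.
  rewrite (big_rem i) //= ltr_pwDl ?mulr_gt0 ?xP //.
  rewrite big_seq sumr_ge0 // => j /mem_rem sj.
  by rewrite mulr_ge0 // ltW // xP.
split.
- by move=> j; case: eqP => _; rewrite ?(ltW s0) ?mulr_ge0.
- by exists a; rewrite ?mem_head ?eqxx.
- rewrite big_cons eqxx scaler_suml -[RHS]lE -big_split /=.
  apply: eq_big_seq => j sj; rewrite not_a // scalerDr !scalerA.
  by rewrite addrC (mulrC p).
Qed.

(** Gordan's alternative for those rows of the cokernel matrix C of A^T whose
    index is outside the support of n.  The image of C is the kernel of A^T, so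
    a small multiple of a vector C x that is positive off the support can be
    added to n; a nonnegative relation among these rows is a vector v with
    v^T C = 0, that is, v is in the image of A. *)
Lemma stiemke (R : realType) (k d : nat) (A : 'M[R]_(k, d)) (n : 'cV[R]_k) :
  (forall i, 0 <= n i 0) ->
  (exists2 y : 'cV[R]_k, (forall i, 0 < y i 0) & A^T *m y = A^T *m n) \/
  (exists z : 'cV[R]_d, [/\ forall i, 0 <= (A *m z) i 0,
     exists i, 0 < (A *m z) i 0 & dot n (A *m z) = 0]).
Proof.
move=> n0; pose C := cokermx A^T.
pose s := [seq i <- enum 'I_k | n i 0 == 0].
have us : uniq s by rewrite filter_uniq ?enum_uniq.
have sP i : (i \in s) = (n i 0 == 0) by rewrite mem_filter mem_enum andbT.
have [[x xP]|[l [l0 [i si li] lE]]] := gordan (fun i => (row i C)^T) us.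
  left; have CE i : (C *m x) i 0 = dot (row i C)^T x.
    by rewrite dotE trmxK -row_mul [RHS]mxE.
  (* Off the support C x is positive and any step works, so only the cells of
     the support restrict e; elsewhere the condition is the trivial 0 < 1. *)
  have [e e0 eP] : exists2 e, 0 < e & forall i, i \in enum 'I_k ->
      0 < (if n i 0 == 0 then 1 else n i 0) +
          e * (if n i 0 == 0 then 0 else (C *m x) i 0).
    apply: small_perturbation => i _.
    by case: ifPn => // ni; rewrite lt_def ni n0.
  exists (n + e *: (C *m x)); last first.
    by rewrite mulmxDr -scalemxAr mulmxA mulmx_coker mul0mx scaler0 addr0.
  move=> i; rewrite !mxE; have := eP i (mem_enum _ _).
  case: eqVneq => [ni _|//]; last by rewrite mxE.
  rewrite ni add0r mulr_gt0 //; have := xP i.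
  by rewrite sP ni eqxx -CE mxE => /(_ isT).
right; pose v : 'cV[R]_k := \col_i (if n i 0 == 0 then l i else 0).
have vC : v^T *m C = 0.
  rewrite mulmx_sum_row -[RHS](trmx0 R _ 1) -lE big_filter.
  rewrite raddf_sum /= [RHS]big_mkcond /= [RHS]big_enum /=.
  apply: eq_bigr => j _.
  rewrite !mxE; case: ifP => _; last by rewrite scale0r.
  by apply/rowP => c; rewrite !mxE.
have /submxP[w wE] : (v^T <= A^T)%MS by rewrite submxE vC.
have vE : A *m w^T = v by rewrite -[LHS]trmxK trmx_mul trmxK -wE trmxK.
exists w^T; rewrite vE; split.
- by move=> j; rewrite mxE; case: ifP.
- by exists i; rewrite mxE -sP si.
- by apply: big1 => j _; rewrite mxE; case: eqVneq => [->|_];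
    rewrite ?mul0r ?mulr0.
Qed.

(** * The relative interior of the marginal cone *)

Section MarginalCone.
Variables (R : realType) (k d : nat) (A : 'M[R]_(k, d)).

Lemma marginal_coneP z : marginal_cone A z <->
  exists2 y : 'cV[R]_k, (forall i, 0 <= y i 0) & z = A^T *m y.
Proof.
have rowE i : (row i A)^T = A^T *m delta_mx i 0 by rewrite -colE tr_row.
split=> [[r [l [x [xP l0 ->]]]]|[y y0 ->]].
  have /choice[f fE] : forall j, exists i, (row i A)^T = x j.
    by move=> j; have [i _ <-] := xP j; exists i.
  exists (\sum_j l j *: delta_mx (f j) 0).
    move=> i; rewrite summxE sumr_ge0 // => j _.
    by rewrite !mxE mulr_ge0.
  rewrite mulmx_sumr; apply: eq_bigr => j _.
  by rewrite -scalemxAr -rowE fE.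
exists k, (fun i => y i 0), (fun i => (row i A)^T); split=> [i|//|].
  by exists i.
rewrite {1}(matrix_sum_delta y) mulmx_sumr; apply: eq_bigr => i _.
by rewrite big_ord1 -scalemxAr rowE.
Qed.

Lemma nbhs_colP (x : 'cV[R]_d) (U : set 'cV[R]_d) :
  nbhs x U <->
  exists2 e : R, 0 < e &
    forall y : 'cV[R]_d, (forall i, `|x i 0 - y i 0| < e) -> U y.
Proof.
split=> [/nbhs_ballP[e /= e0 eU]|[e e0 eU]].
  exists e => // y xy; apply: eU; split=> // i j.
  by rewrite (ord1 j); exact: xy.
by apply/nbhs_ballP; exists e => //= y [_ xy]; apply: eU => i; exact: xy.
Qed.

(** Put t = A^T n.  From left to right: the relative interior allows a short
    step from t away from the point A^T 1, still inside the cone; averaging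
    with A^T 1 leads back to t with positive coefficients.  From right to left:
    a point z of the affine hull differs from t by A^T w with w linear in z - t,
    so y + w stays nonnegative when z is close to t. *)
Lemma relint_marginal_coneP (n : 'cV[R]_k) : (forall i, 0 <= n i 0) ->
  relint (marginal_cone A) (A^T *m n) <->
  exists2 y : 'cV[R]_k, (forall i, 0 < y i 0) & A^T *m y = A^T *m n.
Proof.
move=> n0; split.
  move=> [_ /nbhs_colP[e e0 eU]].
  set t := A^T *m n; pose u := t - A^T *m const_mx 1.
  have [c c0 cP] : exists2 c, 0 < c & forall i, i \in enum 'I_d ->
      0 < e + c * - `|u i 0| by apply: small_perturbation.
  have hullU : affine_hull (marginal_cone A) (t + c *: u).
    exists 2%N, (fun i => if i == 0 then 1 + c else - c),
      (fun i => if i == 0 then t else A^T *m const_mx 1).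
    split.
    - move=> i; apply/marginal_coneP; case: eqP => _; first by exists n.
      by exists (const_mx 1) => // j; rewrite mxE.
    - by rewrite big_ord_recl big_ord1 /=; lra.
    - rewrite big_ord_recl big_ord1 /= scalerDl scale1r scaleNr -addrA.
      by rewrite -scalerBr.
  have /marginal_coneP[y y0 yE] : marginal_cone A (t + c *: u).
    apply: eU => // i; rewrite !mxE opprD addNKr normrN normrM gtr0_norm //.
    by have := cP i (mem_enum _ _); rewrite !mxE; lra.
  have c1 : 0 < 1 + c by lra.
  exists ((1 + c)^-1 *: (y + c *: const_mx 1)).
    move=> i; rewrite !mxE mulr_gt0 ?invr_gt0 //.
    by have := y0 i; lra.
  rewrite -scalemxAr mulmxDr -yE -scalemxAr /u scalerBr -/t.
  rewrite addrA subrK -{1}(scale1r t) -scalerDl scalerA mulVf ?scale1r //.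
  by rewrite gt_eqF.
move=> [y y0 yE]; rewrite -yE; split.
  by apply/marginal_coneP; exists y => // i; rewrite ltW.
pose P := pinvmx A.
have [c c0 cP] : exists2 c, 0 < c & forall i, i \in enum 'I_k ->
    0 < y i 0 + c * - (\sum_j `|P j i|) by apply: small_perturbation.
apply/nbhs_colP; exists c => // z zc [r [l [x [xP l1 zE]]]].
have /choice[f fE] : forall j, exists w, x j = A^T *m w.
  by move=> j; have /marginal_coneP[w _ wE] := xP j; exists w.
have zA : ((z - A^T *m y)^T <= A)%MS.
  rewrite zE; have -> : \sum_i l i *: x i = A^T *m (\sum_i l i *: f i).
    rewrite mulmx_sumr; apply: eq_bigr => i _.
    by rewrite fE scalemxAr.
  by rewrite -mulmxBr trmx_mul trmxK submxMl.
apply/marginal_coneP; exists (y + ((z - A^T *m y)^T *m P)^T).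
  move=> i; rewrite mxE [X in _ + X]mxE; apply: ltW.
  apply: lt_le_trans (cP i (mem_enum _ _)) _.
  rewrite lerD2l mulrN lerNl mxE mulr_sumr (le_trans (ler_norm _)) //.
  rewrite normrN (le_trans (ler_norm_sum _ _ _)) // ler_sum // => j _.
  rewrite normrM ler_wpM2r // ltW //.
  by have := zc j; rewrite distrC !mxE.
by rewrite mulmxDr -trmx_mul mulmxKpV // trmxK addrC subrK.
Qed.

End MarginalCone.

(** * Unordered sums *)

Section Esum.
Variables (R : realType) (T : choiceType) (S : set T).
Implicit Types (f g : T -> R) (s : seq T).

Lemma esum_leP f c : (\esum_(x in S) (f x)%:E <= c%:E)%E <->
  (forall s, uniq s -> (forall x, x \in s -> S x) -> \sum_(x <- s) f x <= c).
Proof.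
split=> [fc s us sS|fc].
  rewrite -lee_fin; apply: le_trans fc; apply: esum_ge.
  exists [set` s]; first by split; [exact: finite_seq|move=> x /=; exact: sS].
  by rewrite -fsbig_seq ?sumEFin.
apply: ge_ereal_sup => _ [X [finX XS] <-].
rewrite fsbig_finite //= sumEFin lee_fin; apply: fc.
  exact: finmap.fset_uniq.
by move=> x; rewrite in_fset_set // inE; exact: XS.
Qed.

Lemma lt_esum f g x0 : (forall x, 0 <= f x) ->
  (forall x, S x -> f x <= g x) -> S x0 -> f x0 < g x0 ->
  (\esum_(x in S) (f x)%:E < +oo)%E ->
  (\esum_(x in S) (f x)%:E < \esum_(x in S) (g x)%:E)%E.
Proof.
move=> f0 fg Sx0 lt0.
have g0 x : S x -> 0 <= g x by move=> Sx; apply: le_trans (fg _ Sx).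
have SE : S `&` [set x0] = [set x0] by apply/setIidPr => x ->.
rewrite !(esumID [set x0] S) ?SE; try by move=> x Sx; rewrite lee_fin ?g0.
rewrite !esum_set1 ?lee_fin ?g0 // => fin.
apply: lte_leD; rewrite ?lte_fin //; last first.
  by apply: le_esum => x [Sx _]; rewrite lee_fin fg.
rewrite ge0_fin_numE; last by apply: esum_ge0 => x _; rewrite lee_fin.
by apply: le_lt_trans fin; rewrite leeDr ?lee_fin.
Qed.

End Esum.

Lemma ler_sum_subset (R : realType) (T : eqType) (s s' : seq T) (f : T -> R) :
  uniq s -> uniq s' -> {subset s <= s'} -> (forall x, 0 <= f x) ->
  \sum_(x <- s) f x <= \sum_(x <- s') f x.
Proof.
move=> us us' ss' f0.
have sE : perm_eq s [seq x <- s' | x \in s].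
  apply: uniq_perm; rewrite ?filter_uniq // => x.
  by rewrite mem_filter andb_idr //; exact: ss'.
rewrite (perm_big _ sE) big_filter big_mkcond /=; apply: ler_sum => x _.
by case: ifP.
Qed.

(** * The base measure *)

Section TableWeights.
Variables (R : realType) (k : nat).
Implicit Types (x : table k) (mu : 'cV[R]_k).

Definition weight x : R := \prod_(i < k) ((x i 0)`!%:R)^-1.

Lemma weight_gt0 x : 0 < weight x.
Proof. by apply: prodr_gt0 => i _; rewrite invr_gt0 ltr0n fact_gt0. Qed.

Lemma weight_expR x mu : weight x * expR (dot (realv R x) mu) =
  \prod_(i < k) exp_coeff (expR (mu i 0)) (x i 0).
Proof.
rewrite /dot expR_sum /weight -big_split /=; apply: eq_bigr => i _.
by rewrite mxE expRM_natl mulrC.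
Qed.

(** A finite set of tables is contained in a box, and the sum over a box is a
    product over the cells of partial sums of exponential series. *)
Lemma sum_weight_expR_le (s : seq (table k)) mu : uniq s ->
  \sum_(x <- s) weight x * expR (dot (realv R x) mu) <=
  \prod_(i < k) expR (expR (mu i 0)).
Proof.
move=> us; pose B := (\max_(x <- s) \max_i x i 0%R)%N.
pose cell (f : {ffun 'I_k -> 'I_B.+1}) : table k := \col_i (f i : nat).
have cellI : injective cell.
  move=> f g /matrixP fg; apply/ffunP => i; apply/val_inj.
  by have := fg i 0; rewrite !mxE.
have sB : {subset s <= [seq cell f | f <- index_enum {ffun 'I_k -> 'I_B.+1}]}.
  move=> x xs; apply/mapP; exists [ffun i => inord (x i 0)].
    by rewrite mem_index_enum.
  apply/matrixP => i j; rewrite ord1 mxE ffunE inordK // ltnS.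
  have := leq_bigmax_seq (F := fun y : table k => \max_i y i 0%R)%N x xs isT.
  by apply: leq_trans; exact: (leq_bigmax i).
apply: le_trans (ler_sum_subset us _ sB _) _.
- by rewrite map_inj_uniq // index_enum_uniq.
- by move=> x; rewrite mulr_ge0 ?expR_ge0 // ltW // weight_gt0.
rewrite big_map.
under eq_bigr do rewrite weight_expR.
under eq_bigr => f _ do under eq_bigr => i _ do rewrite mxE.
rewrite -(bigA_distr_bigA (fun i (j : 'I_B.+1) =>
  exp_coeff (expR (mu i 0)) j)).
apply: ler_prod => i _; rewrite sumr_ge0 /=; last first.
  by move=> j _; rewrite exp_coeff_ge0 // expR_ge0.
rewrite -(big_mkord xpredT (exp_coeff (expR (mu i 0)))).
apply: (nondecreasing_cvgn_le _ (is_cvg_series_exp_coeff _)).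
by apply: nondecreasing_series => j _; rewrite exp_coeff_ge0 // expR_ge0.
Qed.

End TableWeights.

Section BaseMeasureIntegral.
Variables (R : realType) (k m : nat) (V : 'M[R]_(k, m)).
Local Notation S := (sampling_set V).

Lemma nu_set1 x : S x -> nu V [set x] = (weight R x)%:E.
Proof.
move=> Sx; rewrite /nu (_ : _ `&` _ = [set x]); last by apply/setIidPl => y ->.
by rewrite esum_set1 ?lee_fin ?ltW ?weight_gt0.
Qed.

(** Countably additive splitting of S along the enumeration [pickle] of tables,
    whose pieces are empty or singletons. *)
Lemma integral_nu (f : table k -> R) : (forall x, 0 <= f x) ->
  (\int[nu V]_(x in S) (f x)%:E = \esum_(x in S) (weight R x * f x)%:E)%E.
Proof.
move=> f0; have wf0 x : (0 <= (weight R x * f x)%:E)%E.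
  by rewrite lee_fin mulr_ge0 // ltW // weight_gt0.
pose F j : set (table k) := [set x | S x /\ pickle x = j].
have FE : S = \bigcup_j F j.
  apply/seteqP; split=> [x Sx|x [j _ []//]].
  by exists (pickle x).
have tF : trivIset setT F.
  by move=> i j _ _ [x [[_ <-] [_ <-]]].
rewrite {1}FE ge0_integral_bigcup //; last by move=> x _; rewrite lee_fin.
rewrite FE esum_bigcupT // nneseries_esumT; last first.
  by move=> j; apply: integral_ge0 => x _; rewrite lee_fin.
apply: eq_esum => j _.
have [->|/set0P[x Fx]] := eqVneq (F j) set0.
  by rewrite integral_set0 esum_set0.
have -> : F j = [set x].
  apply/seteqP; split=> [y Fy|y ->//].
  by apply: (pcan_inj pickleK); rewrite Fy.2 Fx.2.
rewrite esum_set1 //.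
rewrite (eq_integral (cst (f x)%:E)); last by move=> y; rewrite inE => ->.
by rewrite integral_cst //= nu_set1; [rewrite muleC|exact: Fx.1].
Qed.

Lemma ae_nuP (P : table k -> Prop) :
  {ae nu V, forall x, P x} <-> (forall x, S x -> P x).
Proof.
split=> [[B [_ B0 PB]] x Sx|PS].
  apply: contrapT => nPx; have Bx : B x by apply: PB.
  have : (nu V [set x] <= nu V B)%E.
    by apply: le_measure; rewrite ?inE// => y ->.
  by rewrite B0 nu_set1 // lee_fin leNgt weight_gt0.
exists (~` S); split => //; last by move=> x nPx /PS.
by rewrite /nu setICl esum_set0.
Qed.

End BaseMeasureIntegral.

(** * Finite spanning families and attained minima *)

Lemma dot_span0 (R : realType) (k : nat) (X : seq 'cV[R]_k) (u : 'cV[R]_k) :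
  (forall v, v \in X -> dot v u = 0) -> forall v, v \in <<X>>%VS -> dot v u = 0.
Proof.
move=> X0 v; rewrite -[X in <<X>>%VS]/(tval (in_tuple X)) => /coord_span ->.
rewrite dot_suml big1 // => i _; rewrite dotZl X0 ?mulr0 //.
exact: mem_nth (ltn_ord i).
Qed.

(** A finite family from S whose span has maximal dimension: adding one more
    vector cannot enlarge the span. *)
Lemma finite_span (K : fieldType) (E : vectType K) (T : Type) (S : set T)
    (phi : T -> E) :
  exists r (x : 'I_r -> T), (forall j, S (x j)) /\
    forall y, S y -> phi y \in <<[seq phi (x j) | j <- enum 'I_r]>>%VS.
Proof.
pose P rho := `[< exists s : seq {x | S x},
  \dim <<[seq phi (sval x) | x <- s]>>%VS = rho >].
have P0 : exists rho, P rho.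
  by exists (\dim <<[::] : seq E>>%VS); apply/asboolP; exists [::].
have Pmax rho : P rho -> (rho <= \dim {:E})%N.
  by move=> /asboolP[s <-]; rewrite dimvS // subvf.
case: (ex_maxnP P0 Pmax) => rho /asboolP[s sE] rhomax.
exists (size s), (fun j => sval (tnth (in_tuple s) j)); split.
  by move=> j; exact: svalP.
move=> y Sy.
have -> : [seq phi (sval (tnth (in_tuple s) j)) | j <- enum 'I_(size s)] =
    [seq phi (sval x) | x <- s].
  rewrite (map_comp (fun x => phi (sval x)) (tnth (in_tuple s))).
  by rewrite map_tnth_enum.
have sub : (<<[seq phi (sval x) | x <- s]>> <=
    <<[seq phi (sval x) | x <- exist _ y Sy :: s]>>)%VS.
  by apply: sub_span => v vs; rewrite /= inE vs orbT.
have /eqP -> : (<<[seq phi (sval x) | x <- s]>> ==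
    <<[seq phi (sval x) | x <- exist _ y Sy :: s]>>)%VS.
  rewrite eqEdim sub sE; apply: rhomax; apply/asboolP.
  by exists (exist _ y Sy :: s).
by apply: memv_span; rewrite /= mem_head.
Qed.

(** Lower semicontinuity suffices: the sublevel sets {f <= f v} are closed and
    totally ordered by inclusion, so they have the finite intersection property,
    and any common point is a minimizer. *)
Lemma compact_attains_min (R : realType) (T : ptopologicalType) (K : set T)
    (f : T -> R) : compact K -> K !=set0 ->
  (forall c, closed [set u | f u <= c]) ->
  exists2 u, K u & forall v, K v -> f u <= f v.
Proof.
rewrite compact_In0 => cK [u0 Ku0] cf.
have [||u uP] := cK T K (fun v => K `&` [set u | f u <= f v]).
- by exists (fun v => [set u | f u <= f v]) => // v _; exact: cf.
- move=> D DK.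
  suff [u [Ku uD]] : exists u, K u /\
      forall v, v \in finmap.enum_fset D -> f u <= f v.
    by exists u => v /= vD; split => //; exact: uD.
  have {}DK v : v \in finmap.enum_fset D -> K v by move=> /DK; rewrite inE.
  elim: (finmap.enum_fset D) DK => [|a s IH] DK; first by exists u0.
  have [v vs|u [Ku us]] := IH; first by apply: DK; rewrite inE vs orbT.
  have [ua|au] := leP (f u) (f a).
    by exists u; split=> // v; rewrite inE => /predU1P[->//|]; exact: us.
  exists a; split; first by apply: DK; rewrite mem_head.
  move=> v; rewrite inE => /predU1P[->//|vs].
  by rewrite (le_trans (ltW au)) // us.
- by exists u => [|v Kv]; [have [] := uP _ Ku0 | have [] := uP _ Kv].
Qed.

(** * Sums of exponentials of linear forms *)

Lemma expR_half_sqr (R : realType) (x : R) : expR x = expR (2^-1 * x) ^+ 2.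
Proof. by rewrite -expRM_natl mulrA mulfV ?mul1r // pnatr_eq0. Qed.

Lemma expR_midpoint (R : realType) (a b : R) :
  2 * expR (2^-1 * (a + b)) <= expR a + expR b.
Proof.
rewrite mulrDr expRD (expR_half_sqr a) (expR_half_sqr b).
by have := sqr_ge0 (expR (2^-1 * a) - expR (2^-1 * b)); nra.
Qed.

Lemma expR_midpoint_lt (R : realType) (a b : R) : a != b ->
  2 * expR (2^-1 * (a + b)) < expR a + expR b.
Proof.
move=> ab; rewrite lt_def expR_midpoint andbT; apply: contra ab => /eqP.
rewrite mulrDr expRD (expR_half_sqr a) (expR_half_sqr b) => E.
have /eqP : (expR (2^-1 * a) - expR (2^-1 * b)) ^+ 2 = 0 by nra.
by rewrite sqrf_eq0 subr_eq0 => /eqP /expR_inj /mulfI ->.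
Qed.

Section ExpSum.
Variables (R : realType) (T : choiceType) (d : nat).
Variables (S : set T) (w : T -> R) (phi : T -> 'cV[R]_d).
Hypothesis w_gt0 : forall x, 0 < w x.
Implicit Types (theta : 'cV[R]_d).

Definition expsum_term theta x : R := w x * expR (dot (phi x) theta).

Definition expsum theta : R := fine (\esum_(x in S) (expsum_term theta x)%:E).

Hypothesis expsum_fin :
  forall theta, (\esum_(x in S) (expsum_term theta x)%:E < +oo)%E.

Lemma expsum_term_gt0 theta x : 0 < expsum_term theta x.
Proof. by rewrite mulr_gt0 ?expR_gt0. Qed.

Lemma expsumE theta :
  (\esum_(x in S) (expsum_term theta x)%:E)%E = (expsum theta)%:E.
Proof.
rewrite /expsum fineK // ge0_fin_numE ?expsum_fin //.
by apply: esum_ge0 => x _; rewrite lee_fin ltW ?expsum_term_gt0.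
Qed.

Lemma expsum_leP theta c : expsum theta <= c <->
  (forall s, uniq s -> (forall x, x \in s -> S x) ->
     \sum_(x <- s) expsum_term theta x <= c).
Proof. by rewrite -lee_fin -expsumE; exact: esum_leP. Qed.

Lemma expsum_ge_term theta x : S x -> expsum_term theta x <= expsum theta.
Proof.
move=> Sx; have /expsum_leP/(_ [:: x] isT) := lexx (expsum theta).
by rewrite big_seq1; apply => y; rewrite inE => /eqP ->.
Qed.

Lemma expsum_gt0 theta : S !=set0 -> 0 < expsum theta.
Proof.
move=> [x Sx].
exact: lt_le_trans (expsum_term_gt0 theta x) (expsum_ge_term _ Sx).
Qed.

Lemma eq_expsum theta theta' :
  (forall x, S x -> dot (phi x) theta = dot (phi x) theta') ->
  expsum theta = expsum theta'.
Proof.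
move=> E; rewrite /expsum; congr fine; apply: eq_esum => x Sx.
by rewrite /expsum_term E.
Qed.

Lemma expsum_decreasing theta theta' x0 :
  (forall x, S x -> dot (phi x) theta <= dot (phi x) theta') ->
  S x0 -> dot (phi x0) theta < dot (phi x0) theta' ->
  expsum theta < expsum theta'.
Proof.
move=> le_phi Sx0 lt_phi; rewrite -lte_fin -!expsumE.
apply: (@lt_esum _ _ _ _ _ x0) => //.
- by move=> x; rewrite ltW ?expsum_term_gt0.
- by move=> x Sx; rewrite ler_pM2l // ler_expR le_phi.
- by rewrite ltr_pM2l // ltr_expR.
Qed.

Lemma expsum_midpoint theta theta' x0 :
  S x0 -> dot (phi x0) theta != dot (phi x0) theta' ->
  2 * expsum (2^-1 *: (theta + theta')) < expsum theta + expsum theta'.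
Proof.
move=> Sx0 neq; set mid := 2^-1 *: (theta + theta').
have midE x : dot (phi x) mid = 2^-1 * (dot (phi x) theta + dot (phi x) theta').
  by rewrite dotZr dotDr.
rewrite mulr_natl mulr2n -lte_fin !EFinD -!expsumE.
have ge0 t x : (0 <= (expsum_term t x)%:E)%E.
  by rewrite lee_fin ltW ?expsum_term_gt0.
rewrite -!esumD //.
under eq_esum => x _ do rewrite -EFinD.
under [X in (_ < X)%E]eq_esum => x _ do rewrite -EFinD.
have termE x : expsum_term mid x + expsum_term mid x =
    w x * (2 * expR (2^-1 * (dot (phi x) theta + dot (phi x) theta'))).
  by rewrite /expsum_term midE; ring.
apply: (@lt_esum _ _ _ _ _ x0) => //.
- by move=> x; rewrite addr_ge0 // ltW ?expsum_term_gt0.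
- by move=> x Sx; rewrite termE -mulrDr ler_pM2l // expR_midpoint.
- by rewrite termE -mulrDr ltr_pM2l // expR_midpoint_lt.
- under eq_esum => x _ do rewrite EFinD.
  by rewrite esumD // expsumE -EFinD ltry.
Qed.

(** The parameter theta itself need not stay bounded on the sublevel set of 0,
    since [expsum] may be constant along some directions.  But [expsum theta] is
    a function of the products (phi (x j), theta) for a finite spanning family
    of the phi x: these are the coordinates [coords theta], bounded on that
    sublevel set, and [param] is linear and turns coordinates back into a
    parameter that has them.  On the resulting box the sum is lower
    semicontinuous, as a supremum of finite partial sums. *)
Lemma expsum_attains_min :
  (forall x, S x -> exists b : R, forall theta, expsum theta <= expsum 0 ->
     `|dot (phi x) theta| <= b) ->
  exists theta, forall theta', expsum theta <= expsum theta'.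
Proof.
move=> bounded; have [r [x [Sx spanx]]] := finite_span S phi.
have [b bP] := choice (fun j => bounded _ (Sx j)).
pose C := \matrix_(i < d, j < r) phi (x j) i 0.
pose coords theta : 'rV[R]_r := theta^T *m C.
pose param (u : 'rV[R]_r) : 'cV[R]_d := (u *m pinvmx C)^T.
have coordsE theta j : coords theta 0 j = dot (phi (x j)) theta.
  by rewrite dotC mxE; apply: eq_bigr => i _; rewrite !mxE.
have paramK theta : expsum (param (coords theta)) = expsum theta.
  apply: eq_expsum => y Sy; apply/eqP; rewrite -subr_eq0 -dotBr; apply/eqP.
  apply: dot_span0 (spanx _ Sy) => _ /mapP[j _ ->].
  apply/eqP; rewrite dotBr subr_eq0 -!coordsE /coords trmxK mulmxKpV //.
  exact: submxMl.
pose K := [set u : 'rV[R]_r | forall j, [set` `[- b j, b j]] (u 0 j)].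
have cK : compact K.
  apply: (@rV_compact R r (fun j => [set` `[- b j, b j]])) => j.
  exact: segment_compact.
have Kcoords theta : expsum theta <= expsum 0 -> K (coords theta).
  by move=> le0 j; rewrite /= in_itv /= -ler_norml coordsE bP.
have closedH c : closed [set u | expsum (param u) <= c].
  have -> : [set u | expsum (param u) <= c] = \bigcap_(s in
      [set s | uniq s /\ forall y, y \in s -> S y])
      (fun u => \sum_(y <- s) expsum_term (param u) y) @^-1` [set z | z <= c].
    apply/seteqP; split=> [u /expsum_leP uP s [us sS]|u uP]; first exact: uP.
    by apply/expsum_leP => s us sS; apply: (uP s); split.
  apply: closed_bigI => s _.
  pose lin y (v : 'rV[R]_r) : R := \sum_j v 0 j * (pinvmx C *m phi y) j 0.
  have linE y v : dot (phi y) (param v) = lin y v.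
    by rewrite dotC dotE trmxK -mulmxA mxE.
  have lin_cont y : continuous (lin y).
    apply: (continuous_big (@add_continuous R)) => j _ u.
    by apply: cvgMr_tmp; [exact: nbhs_filter|exact: coord_continuous].
  have sum_cont : continuous (fun v => \sum_(y <- s) expsum_term (param v) y).
    apply: (continuous_big (@add_continuous R)) => y _ u.
    apply: cvgMl_tmp; first exact: nbhs_filter.
    under eq_fun do rewrite linE.
    rewrite linE; apply: (@continuous_comp _ _ _ (lin y) expR).
      exact: lin_cont.
    exact: continuous_expR.
  by move/continuous_closedP : sum_cont; apply; exact: closed_le.
have K0 : K !=set0 by exists (coords 0); apply: Kcoords; exact: lexx.
have [u Ku umin] := compact_attains_min cK K0 closedH.
exists (param u) => theta; have [le0|/ltW ge0] := leP (expsum theta) (expsum 0).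
  by rewrite -(paramK theta); apply: umin; exact: Kcoords.
by apply: le_trans ge0; rewrite -(paramK 0); apply: umin; exact: Kcoords.
Qed.

End ExpSum.

(** * The likelihood *)

Section Likelihood.
Variables (R : realType) (k d m : nat).
Variables (A : 'M[R]_(k, d)) (V : 'M[R]_(k, m)) (n : table k).
Local Notation S := (sampling_set V).
Implicit Types (x : table k) (theta zeta : 'cV[R]_d).

Definition suffstat_diff x : 'cV[R]_d := suffstat A x - suffstat A n.

(** The normalizing sum divided by exp (suffstat A n, theta), which puts the
    inverse of the density at n in the form of a sum of exponentials. *)
Definition inv_density : 'cV[R]_d -> R := expsum S (@weight R k) suffstat_diff.

Lemma dot_suffstat_diff x theta :
  dot (suffstat_diff x) theta = dot (realv R x - realv R n) (A *m theta).
Proof. by rewrite /suffstat_diff /suffstat -mulmxBr dot_trmx. Qed.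

Lemma inv_density_fin theta :
  (\esum_(x in S) (expsum_term (@weight R k) suffstat_diff theta x)%:E < +oo)%E.
Proof.
pose c := expR (- dot (realv R n) (A *m theta)).
apply: (@le_lt_trans _ _
  ((\prod_(i < k) expR (expR ((A *m theta) i 0))) * c)%:E); last exact: ltry.
apply/esum_leP => s us _.
under eq_bigr do rewrite /expsum_term dot_suffstat_diff dotBl expRD mulrA.
by rewrite -mulr_suml ler_pM2r ?expR_gt0 // sum_weight_expR_le.
Qed.

Hypothesis Sn : S n.

Lemma inv_density_gt0 theta : 0 < inv_density theta.
Proof.
by apply: expsum_gt0; [exact: weight_gt0|exact: inv_density_fin|exists n].
Qed.

Lemma densityE theta : density A V theta n = (inv_density theta)^-1.
Proof.
have intE : (\int[nu V]_(x in S) (expR (dot (suffstat A x) theta))%:E =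
    (expR (dot (suffstat A n) theta) * inv_density theta)%:E)%E.
  rewrite EFinM -(expsumE (@weight_gt0 R k) inv_density_fin).
  rewrite -integral_nu; last by move=> x; exact: expR_ge0.
  rewrite -ge0_integralZl_EFin ?expR_ge0 //.
  apply: eq_integral => x _.
  by rewrite -EFinM -expRD dotBl addrC subrK.
rewrite /density /psi intE /= lnM ?posrE ?expR_gt0 ?inv_density_gt0 //.
by rewrite expRK opprD addNKr expRN lnK // posrE inv_density_gt0.
Qed.

Lemma maximizersP theta : maximizers A V n theta <->
  forall theta', inv_density theta <= inv_density theta'.
Proof.
by split=> h theta'; have := h theta';
  rewrite !densityE lef_pV2 ?posrE ?inv_density_gt0.
Qed.

(** The point y is in the relative interior of the polyhedron of [condA2] and
    has the same sufficient statistic as n.  Pushing y away from a sampled table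
    x stays in that set, which bounds (t x - t, theta) from below by the upper
    bounds that hold for all sampled tables. *)
Lemma exists_maximizer_of_positive (M N : {vspace 'cV[R]_k}) (y : 'cV[R]_k) :
  colspan A = M -> (N <= M)%VS -> <<[seq col j V | j <- enum 'I_m]>>%VS = N ->
  condA2 V -> (forall i, 0 < y i 0) -> A^T *m y = A^T *m realv R n ->
  exists theta, maximizers A V n theta.
Proof.
move=> spanA NM spanV hA2 y0 yE.
have Vy : V^T *m y = const_mx 1.
  rewrite -Sn; apply/eqP; rewrite -subr_eq0 -mulmxBr; apply/eqP.
  apply/matrixP => j i; rewrite (ord1 i) mxE [RHS]mxE.
  have -> : \sum_l V^T j l * (y - realv R n) l 0 =
      dot (col j V) (y - realv R n) by apply: eq_bigr => l _; rewrite !mxE.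
  apply: (@dot_span0 _ _ [seq col i A | i <- enum 'I_d]).
    move=> _ /mapP[l _ ->]; have : (A^T *m (y - realv R n)) l 0 = 0.
      by rewrite mulmxBr yE subrr mxE.
    by rewrite mxE => <-; apply: eq_bigr => l' _; rewrite !mxE.
  rewrite -/(colspan A) spanA; apply: (subvP NM); rewrite -spanV.
  by apply: memv_span; apply: map_f; rewrite mem_enum.
suff [theta H] : exists theta, forall theta',
    inv_density theta <= inv_density theta'.
  by exists theta; apply/maximizersP.
apply: expsum_attains_min; [exact: weight_gt0|exact: inv_density_fin|].
(* One summand of F is at most F 0, and u <= exp u. *)
have upper x theta : S x -> inv_density theta <= inv_density 0 ->
    dot (suffstat_diff x) theta <= inv_density 0 / weight R x.
  move=> Sx le0; rewrite ler_pdivlMr ?weight_gt0 // mulrC.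
  apply: le_trans (le_trans (expsum_ge_term (@weight_gt0 R k)
    inv_density_fin theta Sx) le0).
  rewrite ler_pM2l ?weight_gt0 //; apply: le_trans (expR_ge1Dx _).
  by rewrite lerDr.
move=> x Sx.
have [e e0 eP] : exists2 e, 0 < e & forall i, i \in enum 'I_k ->
    0 < y i 0 + e * (y - realv R x) i 0 by apply: small_perturbation.
pose z := y + e *: (y - realv R x).
have : Defs.conv [set realv R x | x in S] z.
  rewrite -hA2; split=> [i|].
    by have := eP i (mem_enum _ _); rewrite !mxE => /ltW.
  by rewrite mulmxDr -scalemxAr mulmxBr Vy Sx subrr scaler0 addr0.
move=> [r [l [p [Sp l0 l1 zE]]]].
have /choice[q qP] : forall j, exists x', S x' /\ realv R x' = p j.
  by move=> j; have [x' Sx' <-] := Sp j; exists x'.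
pose b1 := inv_density 0 / weight R x.
pose b2 := \sum_j l j * (inv_density 0 / weight R (q j)).
have b1_ge0 : 0 <= b1 by rewrite divr_ge0 // ltW ?inv_density_gt0 ?weight_gt0.
have b2_ge0 : 0 <= b2.
  apply: sumr_ge0 => j _; rewrite mulr_ge0 // divr_ge0 //.
    by rewrite ltW ?inv_density_gt0.
  by rewrite ltW ?weight_gt0.
exists (b1 + b2 / e) => theta le0; rewrite ler_norml; apply/andP; split.
  have zn : dot (z - realv R n) (A *m theta) <= b2.
    have -> : z - realv R n = \sum_j l j *: (p j - realv R n).
      under eq_bigr do rewrite scalerBr.
      by rewrite sumrB -zE -scaler_suml l1 scale1r.
    rewrite dot_suml; apply: ler_sum => j _; rewrite dotZl ler_wpM2l //.
    have [Sq <-] := qP j.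
    by rewrite -dot_suffstat_diff; exact: upper.
  have yn : dot y (A *m theta) = dot (realv R n) (A *m theta).
    by rewrite -!dot_trmx yE.
  have : - dot (suffstat_diff x) theta <= b2 / e.
    rewrite ler_pdivlMr // (le_trans _ zn) // dot_suffstat_diff.
    rewrite /z !(dotBl, dotDl, dotZl) yn; lra.
  lra.
by rewrite (le_trans (upper _ _ Sx le0)) // lerDl divr_ge0 // ltW.
Qed.

(** Otherwise Stiemke's alternative gives a direction along which no summand
    of F increases and one of them strictly decreases. *)
Lemma positive_of_maximizer theta :
  (forall i : 'I_k, ~ {ae nu V, forall x, x i 0 = 0%N}) ->
  maximizers A V n theta ->
  exists2 y : 'cV[R]_k, (forall i, 0 < y i 0) & A^T *m y = A^T *m realv R n.
Proof.
move=> ncell /maximizersP thetamin.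
have realv_ge0 x i : 0 <= realv R x i 0 by rewrite mxE ler0n.
have [//|[z [Az0 [i Azi] nAz]]] := stiemke A (realv_ge0 n).
have [x Sx xi] : exists2 x, S x & x i 0 != 0%N.
  apply: contrapT => none; apply: (ncell i); apply/ae_nuP => x Sx.
  by apply/eqP; apply: contrapT => /negP xi; apply: none; exists x.
have diffE x' : dot (suffstat_diff x') (theta - z) =
    dot (suffstat_diff x') theta - dot (realv R x') (A *m z).
  by rewrite dotBr [X in _ - X]dot_suffstat_diff dotBl nAz subr0.
have := thetamin (theta - z); rewrite leNgt => /negP[].
apply: (expsum_decreasing (@weight_gt0 R k) inv_density_fin _ Sx).
  move=> x' Sx'; rewrite diffE gerBl; apply: sumr_ge0 => j _.
  by rewrite mulr_ge0.
rewrite diffE gtrBl; rewrite /dot (bigD1 i) //= ltr_pwDl //.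
  by rewrite mulr_gt0 // mxE ltr0n lt0n.
by apply: sumr_ge0 => j _; rewrite mulr_ge0.
Qed.

Section Identifiability.
Variable N : {vspace 'cV[R]_k}.
Hypothesis spanV : <<[seq col j V | j <- enum 'I_m]>>%VS = N.
Hypothesis nconst : ~ exists gamma : 'cV[R]_k,
  [/\ gamma \in orthv N, gamma != 0 &
      exists c : R, {ae nu V, forall x, dot gamma (realv R x) = c}].

Lemma dot_sampling_diff x v : S x -> v \in N ->
  dot (realv R x - realv R n) v = 0.
Proof.
move=> Sx; rewrite -spanV dotC; apply: dot_span0 => _ /mapP[j _ ->].
have : (V^T *m (realv R x - realv R n)) j 0 = 0.
  by rewrite mulmxBr Sx Sn subrr mxE.
by rewrite mxE => <-; apply: eq_bigr => l _; rewrite !mxE.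
Qed.

(** Only the component of A zeta orthogonal to N is tested by the differences
    x - n, and a nonzero such component would be constant on the samples. *)
Lemma suffstat_diff_null zeta :
  (forall x, S x -> dot (suffstat_diff x) zeta = 0) -> null_params N A zeta.
Proof.
move=> zeta0; rewrite /null_params /=.
have : A *m zeta \in (N + orthv N)%VS by rewrite addv_orthv memvf.
move=> /memv_addP[v Nv [g Ng E]]; rewrite E.
have [->|g0] := eqVneq g 0; first by rewrite addr0.
exfalso; apply: nconst; exists g; split=> //.
exists (dot g (realv R n)); apply/ae_nuP => x Sx.
apply/eqP; rewrite -subr_eq0 -dotBr dotC; apply/eqP.
have := zeta0 x Sx; rewrite dot_suffstat_diff E dotDr.
by rewrite dot_sampling_diff // add0r.
Qed.

(** If some sufficient statistic separated two minimizers of F, then F would be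
    smaller at their midpoint, by strict convexity. *)
Lemma maximizers_class theta :
  maximizers A V n theta -> maximizers A V n = param_class N A theta.
Proof.
move=> /maximizersP thetamin; apply/seteqP; split.
  move=> theta' /maximizersP theta'min; exists (theta' - theta); last first.
    by rewrite addrC subrK.
  apply: suffstat_diff_null => x Sx; rewrite dotBr.
  apply/eqP; rewrite subr_eq0; apply: contrapT => /negP neq.
  have := expsum_midpoint (@weight_gt0 R k) inv_density_fin Sx neq.
  have := thetamin (2^-1 *: (theta' + theta)).
  have := theta'min (2^-1 *: (theta' + theta)).
  rewrite /inv_density; lra.
move=> _ [zeta Nzeta <-]; apply/maximizersP => theta'.
suff -> : inv_density (theta + zeta) = inv_density theta by [].
apply: eq_expsum => x Sx; rewrite dotDr (dot_suffstat_diff _ zeta).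
by rewrite dot_sampling_diff ?addr0.
Qed.

End Identifiability.

End Likelihood.

Lemma orth_proj_ominus0 (R : realType) (k : nat) (M N : {vspace 'cV[R]_k})
    (v : 'cV[R]_k) : v \in N -> orth_proj (ominus M N) v = 0.
Proof.
move=> Nv; have [pU] := orth_projP (ominus M N) v.
move: (orth_proj _ v) pU => p pU /(_ p pU); rewrite dotBr.
have : dot v p = 0.
  by move: pU; rewrite memv_cap => /andP[_ /orthvP]; apply.
rewrite dotC => -> /eqP; rewrite sub0r oppr_eq0 dotvv_eq0.
by move=> /eqP.
Qed.

Theorem theorem3 (R : realType) (I : finType) (d m : nat)
    (M N : {vspace 'cV[R]_#|I|})
    (A : 'M[R]_(#|I|, d)) (V : 'M[R]_(#|I|, m))
    (rowA : forall i : I, row (enum_rank i) A != 0)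
    (spanA : colspan A = M)
    (NsubM : (N <= M)%VS) (NneM : N != M)
    (dimN : \dim N = m)
    (basisV : basis_of N [seq col j V | j <- enum 'I_m])
    (hA0 : condA0 V) (hA1 : condA1 N V) (hA2 : condA2 V)
    (n : table #|I|) (hn : sampling_set V n) :
  (class_mle_exists_unique N A V n <->
     relint (marginal_cone A) (suffstat A n)) /\
  (proj_mle_exists_unique M N A V n <->
     relint (marginal_cone A) (suffstat A n)).
Proof.
have spanV := span_basis basisV; have [nconst ncell] := hA1.
have relintP : relint (marginal_cone A) (suffstat A n) <->
    exists theta, maximizers A V n theta.
  split=> [/relint_marginal_coneP[|y y0 yE]|[theta thetamax]].
  - by move=> i; rewrite mxE ler0n.
  - exact: exists_maximizer_of_positive spanA NsubM spanV hA2 y0 yE.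
  apply/relint_marginal_coneP; first by move=> i; rewrite mxE ler0n.
  exact: positive_of_maximizer ncell thetamax.
have classE theta : maximizers A V n theta ->
  maximizers A V n = param_class N A theta.
  exact: maximizers_class.
split; rewrite relintP; split.
- move=> [theta _ thetaE]; exists theta; rewrite -thetaE.
  by exists 0; rewrite ?addr0 // /null_params /= mulmx0 mem0v.
- by move=> [theta thetamax]; exists theta => //; rewrite (classE theta).
- by move=> [omega omegaE]; have : [set omega] omega by [];
    rewrite -omegaE => -[theta thetamax _]; exists theta.
- move=> [theta thetamax]; exists (proj_loglin_param M N A theta).
  apply/seteqP; split=> [_ [theta' + <-]|_ ->]; last by exists theta.
  rewrite (classE _ thetamax) => -[zeta Nzeta <-].
  rewrite /= /proj_loglin_param mulmxDr linearD /=.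
  by rewrite (orth_proj_ominus0 M Nzeta) addr0.
Qed.
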